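(* $\mathrm{PWPP}(n,n-1)$ polynomial-time reduces to \textsc{Unary Long Choice}.
   Context: All circuits are Boolean circuits of size polynomial in $n$. A search problem $A$ polynomial-time reduces to a search problem $B$ if there are polynomial-time computable maps $f,g$ such that for every instance $I$ of $A$, $f(I)$ is an instance of $B$, and for every solution $s$ of $f(I)$, $g(I,s)$ is a solution of $I$. $\mathrm{PWPP}(n,m)$ (for $m<n$): given a poly($n$)-size circuit $C:\{0,1\}^n\to\{0,1\}^m$, find $x\neq y$ with $C(x)=C(y)$. \textsc{Unary Long Choice}: Let $U=\{0,1\}^n$. The input is a sequence of predicates $P_0,\dots,P_{n-2}$ given by poly($n$)-size circuits, where $P_i:U^{i+2}\to\{0,1\}$ and the value $P_i(a_0,\dots,a_i,x)$ depends only on the last argument $x$ (equivalently, each $P_i$ is given as a circuit $U\to\{0,1\}$ applied to the last argument). A solution is a sequence of $n+1$ distinct elements $a_0,\dots,a_n\in U$ such that for every $i\in\{0,\dots,n-2\}$, $P_i(a_0,\dots,a_i,a_j)$ is the same for all $j>i$. *)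

(* Defs.v *)
From mathcomp Require Import all_boot.
Set Implicit Arguments. Unset Strict Implicit. Unset Printing Implicit Defensive.

(* Boolean circuits as straight-line programs.                         *)
(* Wires 0 .. cin-1 are the inputs; gate number k defines wire cin+k   *)
(* and may only refer to wires with a smaller index.                   *)
Inductive gate : Type :=
| GAnd of nat & nat
| GOr  of nat & nat
| GNot of nat.

Record circuit : Type := Circuit {
  cin   : nat;
  gates : seq gate;
  outs  : seq nat
}.

Definition gate_wf (w : nat) (g : gate) : bool :=
  match g with
  | GAnd i j => (i < w) && (j < w)
  | GOr i j  => (i < w) && (j < w)
  | GNot i   => i < w
  end.

Fixpoint gates_wf (w : nat) (gs : seq gate) : bool :=
  match gs with
  | [::] => true
  | g :: gs' => gate_wf w g && gates_wf w.+1 gs'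
  end.

Definition circuit_wf (C : circuit) : bool :=
  gates_wf (cin C) (gates C) &&
  all (fun o => o < cin C + size (gates C)) (outs C).

Definition eval_gate (vs : seq bool) (g : gate) : bool :=
  match g with
  | GAnd i j => nth false vs i && nth false vs j
  | GOr i j  => nth false vs i || nth false vs j
  | GNot i   => ~~ nth false vs i
  end.

(* value of the circuit on input x (meaningful when size x = cin C) *)
Definition eval_circuit (C : circuit) (x : seq bool) : seq bool :=
  let vs := foldl (fun vs g => rcons vs (eval_gate vs g)) x (gates C) in
  map (fun o => nth false vs o) (outs C).

(* Encodings into bit strings (prefix-free).                           *)
Definition enc_nat (n : nat) : seq bool := nseq n true ++ [:: false].
Definition enc_bits (s : seq bool) : seq bool := enc_nat (size s) ++ s.
Definition enc_gate (g : gate) : seq bool :=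
  match g with
  | GAnd i j => enc_nat 0 ++ enc_nat i ++ enc_nat j
  | GOr i j  => enc_nat 1 ++ enc_nat i ++ enc_nat j
  | GNot i   => enc_nat 2 ++ enc_nat i
  end.
Definition enc_circuit (C : circuit) : seq bool :=
  enc_nat (cin C) ++ enc_nat (size (gates C)) ++ flatten (map enc_gate (gates C))
  ++ enc_nat (size (outs C)) ++ flatten (map enc_nat (outs C)).

(* Deterministic single-tape Turing machines (two-way infinite tape).  *)
(* Tape symbols 'I_(S.+3): 0 = blank, 1 = bit false, 2 = bit true,     *)
(* others = work symbols.  States 'I_(Q.+1), start state 0; the        *)
(* machine halts when the transition function returns None.            *)
Inductive dir : Type := MoveL | MoveR | Stay.

Record TM : Type := MkTM {
  tm_Q : nat;
  tm_S : nat;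
  tm_delta : 'I_tm_Q.+1 -> 'I_tm_S.+3 -> option ('I_tm_Q.+1 * 'I_tm_S.+3 * dir)
}.

Record config (Q S : nat) : Type := Config {
  c_state : 'I_Q.+1;
  c_left  : seq 'I_S.+3;   (* cells left of the head, nearest first *)
  c_cur   : 'I_S.+3;
  c_right : seq 'I_S.+3    (* cells right of the head, nearest first *)
}.

Definition sym_of_bit (S : nat) (b : bool) : 'I_S.+3 := inord (if b then 2 else 1).

Definition init_config (M : TM) (w : seq bool) : config (tm_Q M) (tm_S M) :=
  match w with
  | [::] => Config ord0 [::] ord0 [::]
  | b :: w' => Config ord0 [::] (sym_of_bit _ b) (map (sym_of_bit _) w')
  end.

Definition apply_tr (Q S : nat) (q : 'I_Q.+1) (a : 'I_S.+3) (d : dir)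
  (c : config Q S) : config Q S :=
  match d with
  | Stay => Config q (c_left c) a (c_right c)
  | MoveL => match c_left c with
             | [::] => Config q [::] ord0 (a :: c_right c)
             | l :: ls => Config q ls l (a :: c_right c)
             end
  | MoveR => match c_right c with
             | [::] => Config q (a :: c_left c) ord0 [::]
             | r :: rs => Config q (a :: c_left c) r rs
             end
  end.

Fixpoint exec (M : TM) (t : nat) (c : config (tm_Q M) (tm_S M))
  : option (config (tm_Q M) (tm_S M)) :=
  match tm_delta (c_state c) (c_cur c) with
  | None => Some c
  | Some (q, a, d) =>
      match t with
      | 0 => None
      | t'.+1 => exec t' (apply_tr q a d c)
      end
  end.

Fixpoint read_bits (k : nat) (s : seq 'I_k) : seq bool :=
  match s with
  | [::] => [::]
  | x :: s' => if val x == 1 then false :: read_bits s'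
               else if val x == 2 then true :: read_bits s'
               else [::]
  end.

Definition tm_output (Q S : nat) (c : config Q S) : seq bool :=
  read_bits (c_cur c :: c_right c).

Definition computes_in_poly (M : TM) (k : nat) (w o : seq bool) : Prop :=
  exists2 c', @exec M (k * size w ^ k + k) (init_config M w) = Some c'
            & tm_output c' = o.

Definition pwpp_instance (C : circuit) : Prop :=
  [/\ circuit_wf C, 0 < cin C & size (outs C) = (cin C).-1].

Definition pwpp_solution (C : circuit) (xy : seq bool * seq bool) : Prop :=
  [/\ size xy.1 = cin C, size xy.2 = cin C, xy.1 <> xy.2
    & eval_circuit C xy.1 = eval_circuit C xy.2].

Definition enc_pwpp (C : circuit) : seq bool := enc_circuit C.
Definition enc_pwpp_sol (xy : seq bool * seq bool) : seq bool :=
  enc_bits xy.1 ++ enc_bits xy.2.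

(* An instance is n together with the circuits P_0, ..., P_(n-2), each *)
(* a circuit {0,1}^n -> {0,1} applied to the last argument.            *)
Record ulc : Type := ULC { ulc_n : nat; ulc_P : seq circuit }.

Definition ulc_instance (J : ulc) : Prop :=
  size (ulc_P J) = (ulc_n J).-1 /\
  forall i, i < size (ulc_P J) ->
    let P := nth (Circuit 0 [::] [::]) (ulc_P J) i in
    [/\ circuit_wf P, cin P = ulc_n J & size (outs P) = 1].

Definition ulc_pred (J : ulc) (i : nat) (x : seq bool) : bool :=
  nth false (eval_circuit (nth (Circuit 0 [::] [::]) (ulc_P J) i) x) 0.

Definition ulc_solution (J : ulc) (a : seq (seq bool)) : Prop :=
  [/\ size a = (ulc_n J).+1,
      all (fun x => size x == ulc_n J) a,
      uniq a
    & forall i j k, i < (ulc_n J).-1 -> i < j <= ulc_n J -> i < k <= ulc_n J ->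
        ulc_pred J i (nth [::] a j) = ulc_pred J i (nth [::] a k)].

Definition enc_ulc (J : ulc) : seq bool :=
  enc_nat (ulc_n J) ++ enc_nat (size (ulc_P J)) ++ flatten (map enc_circuit (ulc_P J)).
Definition enc_ulc_sol (a : seq (seq bool)) : seq bool :=
  enc_nat (size a) ++ flatten (map enc_bits a).

Definition pwpp_reduces_to_ulc : Prop :=
  exists (Mf Mg : TM) (k : nat),
    forall C : circuit, pwpp_instance C ->
      exists J : ulc,
        [/\ ulc_instance J,
            computes_in_poly Mf k (enc_pwpp C) (enc_ulc J)
          & forall a, ulc_solution J a ->
              exists xy, pwpp_solution C xy /\
                computes_in_poly Mg k (enc_pwpp C ++ enc_ulc_sol a) (enc_pwpp_sol xy)].

(* Main.v *)
(* The i-th predicate is the i-th output bit of C.  In a solution a_0, ..., a_n all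
   predicates P_0, ..., P_(n-2) agree on a_(n-1) and a_n, so C(a_(n-1)) = C(a_n) and
   these two distinct elements are a collision.

   Both maps are computed without parsing gates.  The encoded collision is a suffix of
   the encoded solution, of length 4n+2: one machine moves a marker four cells to the
   left of the right end for each of the n leading ones, then two more.  The encoding
   of C is h 1^m 0 1^(o_0) 0 ... 1^(o_(m-1)) 0 with m = n-1, so the 0 after 1^m is the
   n-th zero from the right, and the instance 1^n 0 1^m 0 followed by the words
   h 1 0 1^(o_i) 0 is obtained by copying pieces of the input; the other machine writes
   it from right to left on the cells to the left of the input. *)
Require Import Defs.
From HB Require Import structures.
From mathcomp Require Import all_boot zify.
Set Implicit Arguments. Unset Strict Implicit. Unset Printing Implicit Defensive.

(** * Machines over a readable tape alphabet and their translation to [TM] *)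

Inductive sym := Blank | Bit of bool | Dot of bool | Bar | Mark.

Definition sym_code (a : sym) : 'I_7 :=
  inord match a with
        | Blank => 0
        | Bit b => if b then 2 else 1
        | Dot b => if b then 4 else 3
        | Bar => 5
        | Mark => 6
        end.

Definition sym_decode (i : 'I_7) : sym :=
  nth Blank [:: Blank; Bit false; Bit true; Dot false; Dot true; Bar; Mark] i.

Lemma sym_codeK : cancel sym_code sym_decode.
Proof. by case=> [|[]|[]||]; rewrite /sym_decode inordK. Qed.

Notation bits := (map Bit).

Lemma bits_nseq n b : bits (nseq n b) = nseq n (Bit b).
Proof. exact: map_nseq. Qed.

Section Machine.

Variables (st : eqType) (q0 : st) (sts : seq st).
Variable delta : st -> sym -> option (st * sym * dir).
Hypothesis q0_sts : forall q, q \in q0 :: sts.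

Record conf := Conf { cstate : st; cleft : seq sym; ccur : sym; cright : seq sym }.

(* The head is on the first cell of the left part [l] (resp. of the right part
   [r]); an empty part stands for blank cells. *)
Definition at_left q (l r : seq sym) := Conf q (behead l) (head Blank l) r.
Definition at_right q (l r : seq sym) := Conf q l (head Blank r) (behead r).

Definition move q l a r d : conf :=
  match d with
  | Stay => Conf q l a r
  | MoveL => at_left q l (a :: r)
  | MoveR => at_right q (a :: l) r
  end.

Definition step c : option conf :=
  if delta (cstate c) (ccur c) is Some (q, a, d)
  then Some (move q (cleft c) a (cright c) d) else None.

Definition reach T c c' := exists2 t, t <= T & iter t (obind step) (Some c) = Some c'.

Lemma reach_refl T c : reach T c c.
Proof. by exists 0. Qed.

(** A phase spends [t] out of a budget [T] fixed by the goal. A run is thus proved forwards, one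
    phase at a time, and only arithmetic side conditions remain. *)
Lemma reach_trans t T c c1 c2 :
  reach t c c1 -> t <= T -> reach (T - t) c1 c2 -> reach T c c2.
Proof.
move=> [t1 le1 e1] leT [t2 le2 e2]; exists (t2 + t1); first lia.
by rewrite iterD e1.
Qed.

Lemma reach_step T c c1 c2 :
  step c = Some c1 -> 0 < T -> reach T.-1 c1 c2 -> reach T c c2.
Proof.
move=> e T0; rewrite -subn1; apply: (@reach_trans 1) => //.
by exists 1.
Qed.

Lemma reach_le t T c c' : t <= T -> reach t c c' -> reach T c c'.
Proof. by move=> leT rc; apply: reach_trans rc leT (reach_refl _ _). Qed.

(** Covers every loop in which the head runs over cells without changing them. The crossed cells
    pile up reversed on the other side; the accumulator form [catrev] fits the induction on [u]. *)
Lemma sweep_left (p : pred sym) q u l r :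
  (forall a, p a -> delta q a = Some (q, a, MoveL)) -> all p u ->
  reach (size u) (at_left q (u ++ l) r) (at_left q l (rev u ++ r)).
Proof.
move=> dq; rewrite -catrevE.
elim: u r => [|a u IHu] r /=; first by move=> _; exact: reach_refl.
case/andP=> pa pu; apply: reach_step; first by rewrite /step /= dq.
  by [].
exact: IHu.
Qed.

Lemma sweep_right (p : pred sym) q u l r :
  (forall a, p a -> delta q a = Some (q, a, MoveR)) -> all p u ->
  reach (size u) (at_right q l (u ++ r)) (at_right q (rev u ++ l) r).
Proof.
move=> dq; rewrite -catrevE.
elim: u l => [|a u IHu] l /=; first by move=> _; exact: reach_refl.
case/andP=> pa pu; apply: reach_step; first by rewrite /step /= dq.
  by [].
exact: IHu.
Qed.

(** States are numbered by position, so that [q0] gets the number 0 that [init_config] demands. *)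
Definition st_code q : 'I_(size sts).+1 := inord (index q (q0 :: sts)).
Definition st_decode (i : 'I_(size sts).+1) := nth q0 (q0 :: sts) i.

Lemma st_codeK : cancel st_code st_decode.
Proof.
move=> q; have lt_q : index q (q0 :: sts) < (size sts).+1.
  by have := q0_sts q; rewrite -index_mem.
by rewrite /st_decode inordK ?nth_index.
Qed.

Definition compile : TM := @MkTM (size sts) 4 (fun i a =>
  omap (fun x => (st_code x.1.1, sym_code x.1.2, x.2))
       (delta (st_decode i) (sym_decode a))).

Definition conf_code (c : conf) : config (tm_Q compile) (tm_S compile) :=
  @Config (size sts) 4 (st_code (cstate c)) (map sym_code (cleft c))
    (sym_code (ccur c)) (map sym_code (cright c)).

Lemma sym_code_Blank : sym_code Blank = ord0.
Proof. by apply: val_inj; rewrite /= inordK. Qed.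

Lemma init_compile w :
  init_config compile w = conf_code (at_right q0 [::] (bits w)).
Proof.
have e0 : ord0 = st_code q0 by apply: val_inj; rewrite /= inordK //= eqxx.
rewrite /init_config e0 /conf_code /=.
by case: w => [|b w] /=; rewrite ?sym_code_Blank // -map_comp.
Qed.

Lemma exec_step T c c' : step c = Some c' ->
  @exec compile T.+1 (conf_code c) = @exec compile T (conf_code c').
Proof.
rewrite /step /= st_codeK sym_codeK.
case: (delta _ _) => //= -[[q a] d] [<-].
by case: c => q1 [|x l] b [|y r]; case: d => /=; rewrite -?sym_code_Blank.
Qed.

Lemma exec_compile T c c' :
  reach T c c' -> delta (cstate c') (ccur c') = None ->
  @exec compile T (conf_code c) = Some (conf_code c').
Proof.
(* The spare time [s] is harmless: [exec] returns as soon as no transition applies, whatever fuel is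
   left. *)
move=> [t letT]; rewrite -(subnK letT); move: (T - t) => s.
elim: t c {letT} => [|t IHt] c.
  case=> -> dN; rewrite addn0.
  by case: s => [|s] /=; rewrite st_codeK sym_codeK dN.
rewrite iterSr addnS /=; case e: (step c) => [c1|] /=; last first.
  by rewrite (_ : iter t _ None = None) //; elim: t {IHt} => //= t ->.
by move=> /IHt IH /IH <-; rewrite -(exec_step _ e).
Qed.

Lemma read_bits_code u r : (if head Blank r is Bit _ then false else true) ->
  read_bits (map sym_code (bits u ++ r)) = u.
Proof.
elim: u => [|b u IHu] hr /=; last by rewrite inordK; case: b => //=; rewrite IHu.
by case: r hr => [|[|b|[]||] r] //= _; rewrite inordK.
Qed.

(** The output starts under the head and ends at the first non-bit, so the cells in [l] and any
    debris in [r] behind a non-bit may stay on the tape. *)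
Lemma computes_compile k w q l u r T :
  reach T (at_right q0 [::] (bits w)) (at_right q l (bits u ++ r)) ->
  (forall a, delta q a = None) -> (if head Blank r is Bit _ then false else true) ->
  T <= k * size w ^ k + k -> computes_in_poly compile k w u.
Proof.
move=> /reach_le rc dN hr leT; move: (rc _ leT) => {}rc.
exists (conf_code (at_right q l (bits u ++ r))).
  by rewrite init_compile; apply: exec_compile.
rewrite -[RHS](read_bits_code u hr) /tm_output /=.
by case: (bits u ++ r) => //=; rewrite sym_code_Blank.
Qed.

End Machine.

Definition is_bit a := if a is Bit _ then true else false.

Lemma all_bits (p : pred sym) u : (forall b, p (Bit b)) -> all p (bits u).
Proof. by move=> pb; rewrite all_map; apply/allP => b _; apply: pb. Qed.

Lemma is_bit_bits u : all is_bit (bits u).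
Proof. exact: all_bits. Qed.

(** A dot remembers the bit beneath it and [Mark] is only ever put on a zero, so erasing either
    restores the input. *)
Definition unmark a :=
  match a with Dot b => Bit b | Mark => Bit false | _ => a end.

(** * Extraction of the last two elements *)

Inductive pair_state :=
  | PCount | PSeek | PLeft1 | PLeft2 | PLeft3 | PPut | PRewind
  | PFind | PLast | PHalt.

Lemma pair_state_dec : comparable pair_state.
Proof. by rewrite /comparable /decidable; decide equality. Defined.

HB.instance Definition _ := hasDecEq.Build pair_state (compareP pair_state_dec).

(* Every leading 1 moves the dotted position, initially the blank cell after
   the input, four cells to the left. *)
Definition pair_delta q a : option (pair_state * sym * dir) :=
  match q, a with
  | PCount, Bit true => Some (PSeek, Dot true, MoveR)
  | PCount, Bit false => Some (PFind, a, MoveR)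
  | PSeek, Bit _ => Some (PSeek, a, MoveR)
  | PSeek, (Blank | Dot _) => Some (PLeft1, unmark a, MoveL)
  | PLeft1, Bit _ => Some (PLeft2, a, MoveL)
  | PLeft2, Bit _ => Some (PLeft3, a, MoveL)
  | PLeft3, Bit _ => Some (PPut, a, MoveL)
  | PPut, Bit b => Some (PRewind, Dot b, MoveL)
  | PRewind, Bit _ => Some (PRewind, a, MoveL)
  | PRewind, Dot _ => Some (PCount, a, MoveR)
  | PFind, Bit _ => Some (PFind, a, MoveR)
  | PFind, Dot b => Some (PLast, Bit b, MoveL)
  | PLast, Bit _ => Some (PHalt, a, MoveL)
  | _, _ => None
  end.

Definition pair_states :=
  [:: PSeek; PLeft1; PLeft2; PLeft3; PPut; PRewind; PFind; PLast; PHalt].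

Lemma pair_statesP q : q \in PCount :: pair_states.
Proof. by case: q. Qed.

Definition pair_machine := compile PCount pair_states pair_delta.

(** The tape once the dot has moved from the head of [e] to the first bit of [x]; for empty [x] it
    has not moved, which is the base case of the count. *)
Definition dot_head x e :=
  if x is b :: x' then Dot b :: bits x' ++ unmark (head Blank e) :: behead e else e.

Lemma pair_round D l p b0 b1 b2 b3 e :
  (if head Blank e is (Blank | Dot _) then true else false) -> size p + 5 <= D ->
  reach pair_delta (3 * D)
    (at_right PCount l (Bit true :: bits (p ++ [:: b0; b1; b2; b3]) ++ e))
    (at_right PCount (Dot true :: l) (bits p ++ dot_head [:: b0; b1; b2; b3] e)).
Proof.
move=> he leD.
apply: reach_step; [by [] | lia | rewrite /=].
apply: reach_trans.
- by apply: (@sweep_right _ _ is_bit) (is_bit_bits _) => -[].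
- by rewrite size_map size_cat /=; lia.
rewrite size_map size_cat /= map_cat rev_cat -catA /=.
apply: (@reach_step _ _ _ _ (at_left PLeft1 [:: Bit b3, Bit b2, Bit b1, Bit b0 & rev (bits p) ++ Dot true :: l] (unmark (head Blank e) :: behead e))).
- by case: e he => [|[] e].
- lia.
do 4 (apply: reach_step; [by [] | lia | rewrite /=]).
apply: reach_trans.
- by apply: (@sweep_left _ _ is_bit); [case | rewrite all_rev is_bit_bits].
- by rewrite size_rev size_map; lia.
rewrite size_rev size_map revK.
apply: reach_step; [by [] | lia | exact: reach_refl].
Qed.

(** Each round peels four bits off the end of [x]. Its new dot heads the next [e], and [dot_head]
    along a concatenation is a composition of moves. *)
Lemma pair_count D n l p x e :
  size x = 4 * n -> (if head Blank e is (Blank | Dot _) then true else false) ->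
  n + size p + size x <= D ->
  reach pair_delta (n * (3 * D))
    (at_right PCount l (bits (nseq n true ++ p ++ x) ++ e))
    (at_right PCount (nseq n (Dot true) ++ l) (bits p ++ dot_head x e)).
Proof.
elim: n l x e => [|n IHn] l x e sx he leD.
  by case: x sx {leD} => // _; rewrite cats0; apply: reach_refl.
have [b0 [b1 [b2 [b3 ex]]]] : exists b0 b1 b2 b3, drop (4 * n) x = [:: b0; b1; b2; b3].
  have : size (drop (4 * n) x) = 4 by rewrite size_drop; lia.
  by case: (drop _ x) => [|b0 [|b1 [|b2 [|b3 [|]]]]] // _; exists b0, b1, b2, b3.
have stx : size (take (4 * n) x) = 4 * n by rewrite size_takel; lia.
rewrite -(cat_take_drop (4 * n) x) ex; move: (take _ x) stx => y sy.
have -> : nseq n.+1 true ++ p ++ y ++ [:: b0; b1; b2; b3]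
  = true :: (nseq n true ++ p ++ y) ++ [:: b0; b1; b2; b3] by rewrite /= -!catA.
apply: reach_trans.
- by apply: (@pair_round D); rewrite // !size_cat size_nseq; lia.
- by rewrite mulSn leq_addr.
rewrite mulSn addKn.
have -> : nseq n.+1 (Dot true) ++ l = nseq n (Dot true) ++ Dot true :: l.
  by elim: (n) => //= k ->.
have -> : dot_head (y ++ [:: b0; b1; b2; b3]) e
    = dot_head y (dot_head [:: b0; b1; b2; b3] e).
  by case: y {sy} => //= b y; rewrite map_cat -catA.
by apply: IHn => //; lia.
Qed.

(** After the count the dot is on the first bit of [x]. Erasing it and stepping left twice in all
    puts the head on [c], where the output begins. *)
Lemma pair_machine_reach n p c d x :
  0 < n -> size x = 4 * n ->
  let w := nseq n true ++ false :: p ++ [:: c; d] ++ x in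
  exists l, reach pair_delta (4 * (size w).+1 ^ 2)
    (at_right PCount [::] (bits w)) (at_right PHalt l (bits ([:: c; d] ++ x) ++ [:: Blank])).
Proof.
move=> n0 sx w.
pose p' := false :: p ++ [:: c; d].
have ew : w = nseq n true ++ p' ++ x by rewrite /w /p' /= -catA.
have sw : size w = n + size p' + size x by rewrite ew !size_cat size_nseq addnA.
exists (rev (bits (false :: p)) ++ nseq n (Dot true)).
apply: reach_trans.
- rewrite -[bits w]cats0 ew; apply: (@pair_count (size w)) => //; lia.
- by rewrite sw; nia.
(* As [n > 0], [x] is nonempty, so the dot lies on a bit and [PFind] stops there. *)
move: (size w) sw => N sw; case: x sx sw @w {ew} => [|b x] sx sw _; first by move: sx => /=; lia.
rewrite cats0 /=.
apply: reach_step => //; first by rewrite sw; nia.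
apply: reach_trans.
- by apply: (@sweep_right _ _ is_bit) (is_bit_bits _) => -[].
- by rewrite size_map; move: sw; rewrite /p' /=; nia.
apply: reach_step => //.
  rewrite size_map; move: sw; rewrite /p' /=; nia.
rewrite map_cat rev_cat /=.
apply: reach_step => //.
  by rewrite size_cat size_map; move: sw; rewrite /p' /= size_cat /=; nia.
rewrite /= rev_cons cat_rcons; exact: reach_refl.
Qed.

(** * Construction of the Unary Long Choice instance *)

(** [CopyNat] moves one output index, [CopyHead] copies the circuit up to its gates, [CopySize]
    copies the numbers m and n at the very end. *)
Inductive phase := CopyNat | CopyHead | CopySize.

Inductive split_state :=
  | SCount | SSeek | SZero | SRewind | SUndot | SToEnd | SNext
  | SCopy of phase | SCarry of phase & bool | SBack of phase
  | SSep0 | SSep1 | SToMark | SToHead | SToBar | SToZero | SFinal | SHalt.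

Lemma split_state_dec : comparable split_state.
Proof. by rewrite /comparable /decidable; repeat decide equality. Defined.

HB.instance Definition _ := hasDecEq.Build split_state (compareP split_state_dec).

(** Output indices are consumed: erasing them leaves the next one at the right end, where [SToEnd]
    followed by [SNext] finds it. *)
Definition copied ph b := if ph is CopyNat then Blank else Bit b.

(** [SCount] to [SRewind] move [Mark] one zero to the left per leading one; [SUndot] restores these
    ones and puts [Bar] before the input. To copy a bit, [SCopy] dots it, [SCarry] brings it to the
    first blank on the left and [SBack] returns to the dot. *)
Definition split_delta q a : option (split_state * sym * dir) :=
  match q, a with
  | SCount, Bit true => Some (SSeek, Dot true, MoveR)
  | SCount, Bit false => Some (SUndot, a, MoveL)
  | SSeek, Bit _ => Some (SSeek, a, MoveR)
  | SSeek, (Blank | Mark) => Some (SZero, unmark a, MoveL)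
  | SZero, Bit true => Some (SZero, a, MoveL)
  | SZero, Bit false => Some (SRewind, Mark, MoveL)
  | SRewind, Bit _ => Some (SRewind, a, MoveL)
  | SRewind, Dot _ => Some (SCount, a, MoveR)
  | SUndot, Dot b => Some (SUndot, Bit b, MoveL)
  | SUndot, Blank => Some (SToEnd, Bar, MoveR)
  | SToEnd, Blank => Some (SNext, a, MoveL)
  | SToEnd, _ => Some (SToEnd, a, MoveR)
  | SNext, Bit false => Some (SCarry CopyNat false, Dot false, MoveL)
  | SNext, Mark => Some (SCarry CopySize false, Dot false, MoveL)
  | SCopy CopyNat, (Bit false | Mark) => Some (SSep0, a, Stay)
  | SCopy CopyHead, Bar => Some (SToEnd, a, Stay)
  | SCopy CopySize, Bit false => Some (SToBar, a, Stay)
  | SCopy CopySize, Bar => Some (SFinal, a, Stay)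
  | SCopy ph, Bit b => Some (SCarry ph b, Dot b, MoveL)
  | SCarry ph b, Blank => Some (SBack ph, Bit b, MoveR)
  | SCarry _ _, _ => Some (q, a, MoveL)
  | SBack ph, Dot b => Some (SCopy ph, copied ph b, MoveL)
  | SBack _, _ => Some (q, a, MoveR)
  | SSep0, Blank => Some (SSep1, Bit false, MoveL)
  | SSep0, _ => Some (SSep0, a, MoveL)
  | SSep1, Blank => Some (SToMark, Bit true, MoveR)
  | SToMark, Mark => Some (SToHead, a, MoveL)
  | SToMark, _ => Some (SToMark, a, MoveR)
  | SToHead, Bit true => Some (SToHead, a, MoveL)
  | SToHead, Bit false => Some (SCopy CopyHead, a, Stay)
  | SToBar, Bar => Some (SToZero, a, MoveR)
  | SToBar, _ => Some (SToBar, a, MoveL)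
  | SToZero, Bit true => Some (SToZero, a, MoveR)
  | SToZero, Bit false => Some (SCarry CopySize false, Dot false, MoveL)
  | SFinal, Blank => Some (SHalt, a, MoveR)
  | SFinal, _ => Some (SFinal, a, MoveL)
  | _, _ => None
  end.

Definition split_states :=
  [:: SSeek; SZero; SRewind; SUndot; SToEnd; SNext; SSep0; SSep1; SToMark;
      SToHead; SToBar; SToZero; SFinal; SHalt]
  ++ flatten [seq [:: SCopy ph; SBack ph; SCarry ph false; SCarry ph true]
             | ph <- [:: CopyNat; CopyHead; CopySize]].

Lemma split_statesP q : q \in SCount :: split_states.
Proof. by case: q => [|||||||[]|[] []|[]||||||||]. Qed.

Definition split_machine := compile SCount split_states split_delta.

(** * Marking the zero that ends 1^m *)

Lemma mark_round D l p z e :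
  (if head Blank e is (Blank | Mark) then true else false) -> size p + z + 4 <= D ->
  reach split_delta (2 * D)
    (at_right SCount l (bits (true :: p ++ false :: nseq z true) ++ e))
    (at_right SCount (Dot true :: l)
       (bits p ++ Mark :: nseq z (Bit true) ++ unmark (head Blank e) :: behead e)).
Proof.
move=> he leD.
apply: reach_step; [by [] | lia | rewrite /=].
apply: reach_trans.
- by apply: (@sweep_right _ _ is_bit) (is_bit_bits _) => -[].
- by rewrite size_map size_cat /= size_nseq; lia.
rewrite size_map size_cat /= size_nseq map_cat rev_cat /= rev_cons bits_nseq rev_nseq.
rewrite cat_rcons -catA.
apply: (@reach_step _ _ _ _ (at_left SZero (nseq z (Bit true) ++ Bit false :: rev (bits p) ++ Dot true :: l) (unmark (head Blank e) :: behead e))).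
- by case: e he => [|[] e].
- lia.
apply: reach_trans.
- by apply: (@sweep_left _ _ (fun a => if a is Bit true then true else false)) => [[|[]|||]|] //; rewrite all_nseq orbT.
- by rewrite size_nseq; lia.
rewrite size_nseq rev_nseq.
apply: reach_step; [by [] | lia | rewrite /=].
apply: reach_trans.
- by apply: (@sweep_left _ _ is_bit); [case | rewrite all_rev is_bit_bits].
- by rewrite size_rev size_map; lia.
rewrite size_rev size_map revK.
apply: reach_step; [by [] | lia | exact: reach_refl].
Qed.

Definition enc_nats s := flatten (map enc_nat s).

Lemma enc_nats_rcons s y : enc_nats (rcons s y) = enc_nats s ++ nseq y true ++ [:: false].
Proof. by rewrite /enc_nats map_rcons flatten_rcons. Qed.

(** Each index contains exactly one zero, its terminator, so one round more than there are indices
    reaches the zero before [enc_nats ys]. The induction drops the last index, whose ones become the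
    [z] of the next round. *)
Lemma mark_count D ys l p z e :
  (if head Blank e is (Blank | Mark) then true else false) ->
  size ys + size p + size (enc_nats ys) + z + 5 <= D ->
  reach split_delta ((size ys).+1 * (2 * D))
    (at_right SCount l
       (bits (nseq (size ys).+1 true ++ p ++ false :: enc_nats ys ++ nseq z true) ++ e))
    (at_right SCount (nseq (size ys).+1 (Dot true) ++ l)
       (bits p ++ Mark :: bits (enc_nats ys) ++ nseq z (Bit true)
        ++ unmark (head Blank e) :: behead e)).
Proof.
elim/last_ind: ys l z e => [|ys y IHys] l z e he.
  by move=> /= leD; rewrite mul1n; apply: mark_round => //; lia.
rewrite size_rcons enc_nats_rcons !size_cat size_nseq addn1 => leD.
set p1 := nseq (size ys).+1 true ++ p ++ false :: enc_nats ys ++ nseq y true.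
have -> : nseq (size ys).+2 true ++ p
       ++ false :: (enc_nats ys ++ nseq y true ++ [:: false]) ++ nseq z true
     = true :: p1 ++ false :: nseq z true.
  by rewrite /p1 /= -!catA /= -!catA.
rewrite mulSn; apply: reach_trans.
- apply: (@mark_round D) => //.
  by rewrite /p1 !(size_cat, size_nseq) /= !(size_cat, size_nseq); lia.
- exact: leq_addr.
rewrite addKn.
have -> : nseq (size ys).+2 (Dot true) ++ l = nseq (size ys).+1 (Dot true) ++ Dot true :: l.
  by elim: (size ys) => //= k ->.
have -> : bits (enc_nats ys ++ nseq y true ++ [:: false]) ++ nseq z (Bit true)
            ++ unmark (head Blank e) :: behead e
   = bits (enc_nats ys) ++ nseq y (Bit true) ++ Bit false
            :: nseq z (Bit true) ++ unmark (head Blank e) :: behead e.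
  by rewrite !map_cat bits_nseq -!catA.
by apply: (IHys _ y (Mark :: nseq z (Bit true) ++ unmark (head Blank e) :: behead e)) => //; lia.
Qed.

Lemma undot_reach n r :
  reach split_delta n (at_left SUndot (nseq n (Dot true)) r)
    (at_left SUndot [::] (nseq n (Bit true) ++ r)).
Proof.
elim: n r => [|n IHn] r; first exact: reach_refl.
apply: reach_step; [by [] | by [] | rewrite /=].
have -> : Bit true :: nseq n (Bit true) ++ r = nseq n (Bit true) ++ Bit true :: r.
  by elim: (n) => //= k ->.
exact: IHn.
Qed.

Definition nonblank a := if a is Blank then false else true.

Lemma nonblank_bits u : all nonblank (bits u).
Proof. exact: all_bits. Qed.

Lemma to_end_reach u l k : all nonblank u ->
  reach split_delta (size u).+1 (at_right SToEnd l (u ++ nseq k Blank))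
    (at_left SNext (rev u ++ l) (Blank :: nseq k.-1 Blank)).
Proof.
move=> nu; apply: reach_trans.
- by apply: (@sweep_right _ _ nonblank) nu => -[].
- lia.
by apply: reach_step; [case: k | lia | case: k => [|k]; apply: reach_refl].
Qed.

Lemma split_prepare D ys p :
  size ys + size p + size ys + size (enc_nats ys) + 7 <= D ->
  let n := (size ys).+1 in
  reach split_delta (n.+2 * (2 * D))
    (at_right SCount [::]
       (bits (nseq n true ++ (false :: p) ++ enc_nats (size ys :: ys))))
    (at_left SNext (bits (rev (enc_nats ys)) ++ Mark :: nseq (size ys) (Bit true)
       ++ bits (rev (nseq n true ++ false :: p)) ++ [:: Bar]) [:: Blank]).
Proof.
move=> leD n.
(* The ones of 1^m join the prefix of [mark_count], and [z] is 0 because the input ends in a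
   zero. *)
have -> : (false :: p) ++ enc_nats (size ys :: ys)
    = (false :: p ++ nseq (size ys) true) ++ false :: enc_nats ys ++ nseq 0 true.
  by rewrite cats0 /enc_nats /= /enc_nat -!catA.
apply: reach_trans.
- rewrite -[bits _]cats0; apply: (@mark_count D) => //.
  by rewrite /= size_cat size_nseq; lia.
- by rewrite /n; nia.
rewrite -mulnBl subSn // subSn // subnn.
apply: reach_step; [by [] | lia | rewrite cats0 -/n].
apply: reach_trans; [exact: undot_reach | by rewrite /n; lia | ].
apply: reach_step; [by [] | by rewrite /n; lia |].
set u := bits (nseq n true ++ false :: p ++ nseq (size ys) true) ++ Mark :: bits (enc_nats ys).
apply: (@reach_le _ _ (size u).+1).
  by rewrite /u /n !(size_cat, size_map, size_nseq) /= !(size_cat, size_map, size_nseq) /=; lia.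
have nu : all nonblank u by rewrite all_cat /= !nonblank_bits.
have := to_end_reach [:: Bar] 1 nu.
congr (reach _ _ _ _).
  by rewrite /u !map_cat bits_nseq /= map_cat -!catA /= -?catA.
congr at_left.
rewrite /u !rev_cat rev_cons -!map_rev !rev_cat !rev_cons rev_cat rev_nseq.
by rewrite -!cats1 !map_cat bits_nseq -!catA /=.
Qed.

(** * Copying pieces of the input to the left of [Bar] *)

Definition passable a := if a is (Blank | Dot _) then false else true.

Lemma passable_bits u : all passable (bits u).
Proof. exact: all_bits. Qed.

Lemma passable_ones n : all passable (nseq n (Bit true)).
Proof. by rewrite all_nseq orbT. Qed.

(** No blank in [x] stops the way out early and no dot in [x] stops the way back before the source
    bit. *)
Lemma carry_reach D ph b x r : all passable x -> size x <= D ->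
  reach split_delta (2 * D + 2) (at_left (SCarry ph b) x (Dot b :: r))
    (at_left (SCopy ph) (x ++ [:: Bit b]) (copied ph b :: r)).
Proof.
move=> px leD; rewrite -[x in at_left (SCarry _ _) x]cats0.
apply: reach_trans.
- by apply: (@sweep_left _ _ passable) px => -[].
- lia.
apply: reach_step; [by [] | lia | rewrite /=].
apply: reach_trans.
- by apply: (@sweep_right _ _ passable); [case | rewrite all_rev].
- by rewrite size_rev; lia.
rewrite size_rev revK; apply: reach_step; [by [] | lia | exact: reach_refl].
Qed.

(** Each copied bit leaves the front of the left part and reappears at its far end, so the length
    bounded by [D] is invariant. The condition on [u] reflects that the number phases stop at a
    zero. *)
Lemma copy_reach D ph u x r :
  all (fun b => b || if ph is CopyHead then true else false) u ->
  all passable x -> size u + size x <= D ->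
  reach split_delta (size u * (2 * D + 3)) (at_left (SCopy ph) (bits u ++ x) r)
    (at_left (SCopy ph) (x ++ bits u) (rev (map (copied ph) u) ++ r)).
Proof.
elim: u x r => [|b u IHu] x r /=; first by rewrite cats0 => *; apply: reach_refl.
case/andP=> acc_b acc_u px leD.
apply: (@reach_step _ _ _ _ (at_left (SCarry ph b) (bits u ++ x) (Dot b :: r))).
- by case: ph acc_b {acc_u IHu} => //; case: b.
- nia.
apply: reach_trans.
- by apply: (@carry_reach D); rewrite ?all_cat ?passable_bits ?size_cat ?size_map //; lia.
- nia.
rewrite rev_cons cat_rcons -[Bit b :: bits u]cat1s catA -catA.
apply: reach_le (IHu _ _ acc_u _ _); first nia.
- by rewrite all_cat px.
- by rewrite size_cat /=; lia.
Qed.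

Definition rev_nat z := false :: nseq z true.
(** One predicate circuit, reversed since the output is written from right to left;
    [[:: false; true]] is the reversed [enc_nat 1] for its single output. *)
Definition rev_block h z := rev_nat z ++ [:: false; true] ++ h.

Lemma copy_nat_reach D z x k :
  all passable x -> z + size x + 1 <= D ->
  reach split_delta (z.+1 * (2 * D + 3))
    (at_left SNext (bits (rev_nat z) ++ x) (nseq k Blank))
    (at_left (SCopy CopyNat) (x ++ bits (rev_nat z)) (nseq (z.+1 + k) Blank)).
Proof.
move=> px leD; rewrite mulSn; apply: reach_step; [by [] | lia | rewrite /=].
apply: reach_trans.
- apply: (@carry_reach D).
    by rewrite all_cat passable_bits.
  by rewrite size_cat size_map size_nseq; lia.
- lia.
rewrite -catA; apply: (@reach_le _ _ (size (nseq z true) * (2 * D + 3))).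
  by rewrite size_nseq; lia.
have := @copy_reach D CopyNat (nseq z true) (x ++ [:: Bit false]) (Blank :: nseq k Blank).
rewrite -catA all_nseq orbT all_cat px size_cat size_nseq /= addn1 => /(_ erefl erefl).
move=> H; have {H} := H ltac:(lia); congr (reach _ _ _ _).
congr at_left; rewrite map_nseq rev_nseq /=.
by elim: (z) => //= i ->.
Qed.

(* The tape to the left of the head between two blocks: [s] lists the outputs
   still to be treated, last one first, [h] is the reversed common prefix of the
   circuits to be written and [o] the reversed part of the output so far. *)
Definition split_tape m h s o :=
  bits (flatten (map rev_nat s)) ++ Mark :: nseq m (Bit true)
  ++ bits h ++ Bar :: bits o.

Lemma size_split_tape m h s o : size (split_tape m h s o)
  = size (flatten (map rev_nat s)) + m + size h + size o + 2.
Proof.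
by rewrite /split_tape size_cat /= size_cat size_nseq size_cat /= !size_map; lia.
Qed.

(** Only [z + size h + 2] of the [z + size h + 4] bits of the block are carried; the budget of the
    two separator bits pays for all the sweeps in between. *)
Lemma block_reach D z zs m h o k :
  let tape := split_tape m (false :: h) in
  let b := rev_block (false :: h) z in
  size (tape zs (o ++ b)) + 10 <= D ->
  exists k', reach split_delta (size b * (2 * D + 3))
    (at_left SNext (tape (z :: zs) o) (nseq k Blank))
    (at_left SNext (tape zs (o ++ b)) (nseq k' Blank)).
Proof.
move=> tape b leD0.
pose rest := bits (flatten (map rev_nat zs)); pose hd := bits (false :: h).
have srest : size rest = size (flatten (map rev_nat zs)) by rewrite size_map.
have sb : size b = z + size h + 4.
  by rewrite /b /rev_block !size_cat /= size_nseq; lia.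
have leD : size rest + m + size h + size o + size b + 13 <= D.
  by rewrite sb srest; move: leD0; rewrite size_split_tape size_cat sb /=; lia.
have prest : all passable rest by apply: passable_bits.
pose a := nseq m (Bit true) ++ hd ++ Bar :: bits (o ++ rev_nat z).
have pa : all passable a by rewrite !all_cat passable_ones /= !passable_bits.
have sa : size a = m + (size h + size o + z + 3).
  by rewrite /a /hd size_cat size_nseq size_cat /= !size_map size_cat /= size_nseq; lia.
(* Erasing the index adds [z.+1] blanks; [to_end_reach] returns their number in this form. *)
exists (z.+1 + k).-1.+1.
apply: reach_trans.
- have -> : tape (z :: zs) o = bits (rev_nat z) ++ rest ++ Mark
      :: nseq m (Bit true) ++ hd ++ Bar :: bits o by rewrite /tape /split_tape /= map_cat -catA.
  apply: (@copy_nat_reach D).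
    by rewrite all_cat prest -cat1s !all_cat passable_ones /= !passable_bits.
  by rewrite size_cat -cat1s !size_cat size_nseq /= !size_map; lia.
- by rewrite sb; nia.
have -> : (rest ++ Mark :: nseq m (Bit true) ++ hd ++ Bar :: bits o) ++ bits (rev_nat z)
    = rest ++ Mark :: a.
  by rewrite /a map_cat -cat1s -[in RHS]cat1s -[Bar :: bits o]cat1s -[Bar :: _ ++ _]cat1s -!catA.
apply: (@reach_le _ _ (1 + (size rest + (size a).+1) + 2 + (size a).+1 + 1
   + m + 1 + (size h).+1 * (2 * D + 3) + 1 + (size rest + m + size h + 4))); first nia.
move: (_ + k) => k1.
(* The copying of the index stops at the zero of the next index, or at [Mark] after the last one.
   The appended [[::]] stands for the blank cells beyond the output. *)
apply: (@reach_step _ _ _ _ (at_left SSep0 ((rest ++ Mark :: a) ++ [::]) (nseq k1 Blank))).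
- by rewrite cats0 /rest; case: (zs).
- lia.
apply: reach_trans.
- apply: (@sweep_left _ _ passable); first by case.
  by rewrite all_cat prest.
- by rewrite size_cat /=; lia.
apply: reach_step; [by [] | rewrite size_cat /=; lia | rewrite /=].
apply: reach_step; [by [] | rewrite size_cat /=; lia | rewrite /=].
have -> : Bit false :: rev (rest ++ Mark :: a) ++ nseq k1 Blank
    = rev (a ++ [:: Bit false]) ++ Mark :: rev rest ++ nseq k1 Blank.
  by move: a (rest) {pa sa} => a' r'; rewrite !rev_cat rev_cons -!catA cat_rcons.
apply: reach_trans.
- apply: (@sweep_right _ _ (fun c => if c is Mark then false else true)).
    by case.
  by rewrite all_rev !all_cat all_nseq orbT /= !all_bits.
- by rewrite size_rev (size_cat a) (size_cat rest) /=; lia.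
rewrite size_rev (size_cat a) (size_cat rest) -[size [:: _]]/1 -[size (Mark :: a)]/(size a).+1 revK.
apply: reach_step; [by [] | lia | ].
have -> : (a ++ [:: Bit false]) ++ [:: Bit true]
    = nseq m (Bit true) ++ hd ++ Bar :: bits (o ++ rev_nat z ++ [:: false; true]).
  by rewrite /a -!catA !map_cat cat_cons -!catA.
(* The ones of 1^m can be crossed without counting because the prefix ends in a zero, hence its
   reversed form [false :: h]. *)
apply: reach_trans.
- apply: (@sweep_left _ _ (fun c => if c is Bit true then true else false)).
    by case=> [|[]|||].
  by rewrite all_nseq orbT.
- rewrite size_nseq; lia.
apply: reach_step; [by [] | rewrite size_nseq; lia | rewrite rev_nseq size_nseq].
apply: reach_trans.
- apply: (@copy_reach D CopyHead (false :: h)).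
  + by apply/allP => c _; rewrite orbT.
  + by rewrite /= passable_bits.
  by rewrite /= size_map size_cat /= size_cat size_nseq /=; lia.
- by rewrite -[size (_ :: h)]/(size h).+1; lia.
rewrite -[size (_ :: h)]/(size h).+1.
apply: reach_step; [by [] | lia | ].
pose u := Bar :: rev hd ++ nseq m (Bit true) ++ Mark :: rev rest.
have nu : all nonblank u.
  by rewrite /= !all_cat all_nseq orbT /= !all_rev /= !nonblank_bits.
have := to_end_reach (bits (o ++ rev_nat z ++ [:: false; true] ++ false :: h)) k1 nu.
have su : size u = size rest + m + size h + 3.
  by rewrite /u /= !size_cat /= !size_rev /= size_nseq size_map; lia.
rewrite su => ru; apply: (@reach_le _ _ (size rest + m + size h + 4)); first nia.
move: ru; congr (reach _ _ _ _).
- lia.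
- rewrite /at_right /=; congr Conf.
    by rewrite -[_ :: bits h]/(bits (false :: h)) -map_cat -catA /= -catA.
  by rewrite -[in LHS]catA -catA.
- congr at_left; rewrite /u /tape /split_tape /b -/rest -/hd rev_cons !rev_cat rev_cons !revK rev_nseq.
  by rewrite -!cats1 -!catA.
Qed.

Lemma blocks_reach D zs m h o k :
  let b := flatten (map (rev_block (false :: h)) zs) in
  size (split_tape m (false :: h) zs (o ++ b)) + 10 <= D ->
  exists k', reach split_delta (size b * (2 * D + 3))
    (at_left SNext (split_tape m (false :: h) zs o) (nseq k Blank))
    (at_left SNext (split_tape m (false :: h) [::] (o ++ b)) (nseq k' Blank)).
Proof.
elim: zs o k => [|z zs IHzs] o k b leD.
  by exists k; rewrite /b /= cats0; apply: reach_refl.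
have eb : b = rev_block (false :: h) z ++ flatten (map (rev_block (false :: h)) zs) by [].
rewrite eb in leD *; rewrite [o ++ _]catA in leD *.
have {}leD : size (split_tape m (false :: h) zs ((o ++ rev_block (false :: h) z)
    ++ flatten (map (rev_block (false :: h)) zs))) + 10 <= D.
  move: leD; rewrite !size_split_tape [flatten (map rev_nat (z :: _))]/= /=.
  by rewrite size_cat; lia.
have [k1 r1] : exists k', reach split_delta (size (rev_block (false :: h) z) * (2 * D + 3))
    (at_left SNext (split_tape m (false :: h) (z :: zs) o) (nseq k Blank))
    (at_left SNext (split_tape m (false :: h) zs (o ++ rev_block (false :: h) z))
       (nseq k' Blank)).
  apply: block_reach; apply: leq_trans leD.
  by rewrite !size_split_tape !size_cat; lia.
have [k2 r2] := IHzs _ k1 leD.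
exists k2; apply: reach_trans r1 _ _; rewrite size_cat mulnDl ?leq_addr // addKn.
exact: r2.
Qed.

(** With all indices consumed, [SNext] meets [Mark], which is the zero ending 1^m and is copied as
    such. The zero in front of [h] ends the ones of m, and the zero nearest to [Bar] ends the ones
    of n; [Bar] finally delimits the output. *)
Lemma finish_reach D m n h h1 h2 o r :
  h = false :: h2 -> h = h1 ++ false :: nseq n true ->
  size (split_tape m h [::] o) + m + n + 10 <= D ->
  exists r', reach split_delta ((m + n + 5) * (2 * D + 3))
    (at_left SNext (split_tape m h [::] o) r)
    (at_right SHalt [:: Blank] (bits (rev (o ++ rev_nat m ++ rev_nat n)) ++ Bar :: r')).
Proof.
move=> eh eh1; rewrite size_split_tape /= => leD.
pose o1 := o ++ rev_nat m; pose o2 := o1 ++ rev_nat n.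
have so1 : size o1 = size o + m + 1 by rewrite size_cat /= size_nseq; lia.
have so2 : size o2 = size o + m + n + 2 by rewrite size_cat so1 /= size_nseq; lia.
have copy_size x z r1 : all passable x -> size x + z + 2 <= D ->
    exists r2, reach split_delta (z.+1 * (2 * D + 3))
      (at_left (SCarry CopySize false) (nseq z (Bit true) ++ x) (Dot false :: r1))
      (at_left (SCopy CopySize) (x ++ bits (rev_nat z)) r2).
  move=> px lex; rewrite -bits_nseq -[rev_nat z]/([:: false] ++ nseq z true) map_cat.
  exists (rev (map (copied CopySize) (nseq z true)) ++ copied CopySize false :: r1).
  rewrite mulSn; apply: reach_trans.
  - by apply: (@carry_reach D); rewrite ?all_cat ?passable_bits ?size_cat ?size_map ?size_nseq //; lia.
  - lia.
  rewrite -catA; apply: reach_le.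
    by apply: (_ : size (nseq z true) * (2 * D + 3) <= _); rewrite size_nseq; lia.
  rewrite [x ++ bits _ ++ _]catA; apply: (@copy_reach D).
  - by rewrite all_nseq orbT.
  - by rewrite all_cat px.
  - by rewrite size_cat size_nseq /=; lia.
have [||r1 reach1] := copy_size (bits h ++ Bar :: bits o) m r.
- by rewrite all_cat /= !passable_bits.
- by rewrite size_cat /= !size_map; lia.
have [||r2 reach2] := copy_size (Bar :: bits o1) n (bits (rev h1) ++ r1).
- by rewrite /= passable_bits.
- by rewrite /= size_map so1; lia.
have sh : size h = size h1 + n + 1 by rewrite eh1 size_cat /= size_nseq; lia.
exists r2.
apply: (@reach_le _ _ (1 + m.+1 * (2 * D + 3) + (size h + n + 3)
  + n.+1 * (2 * D + 3) + (size o2 + 3))); first lia.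
apply: reach_step; [by [] | lia |].
apply: reach_trans reach1 _ _; first lia.
have -> : (bits h ++ Bar :: bits o) ++ bits (rev_nat m) = bits h ++ Bar :: bits o1.
  by rewrite map_cat -catA.
apply: (@reach_step _ _ _ _ (at_left SToBar (bits h ++ Bar :: bits o1) r1)).
- by rewrite eh.
- lia.
apply: reach_trans.
- by apply: (@sweep_left _ _ is_bit) (is_bit_bits _) => -[].
- by rewrite size_map; lia.
rewrite size_map.
apply: (@reach_step _ _ _ _ (at_right SToZero (Bar :: bits o1)
  (nseq n (Bit true) ++ Bit false :: bits (rev h1) ++ r1))).
- rewrite -map_rev eh1 rev_cat rev_cons rev_nseq map_cat map_rcons bits_nseq.
  by rewrite -catA cat_rcons.
- lia.
apply: reach_trans.
- apply: (@sweep_right _ _ (fun c => if c is Bit true then true else false)).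
    by case=> [|[]|||].
  by rewrite all_nseq orbT.
- by rewrite size_nseq; lia.
rewrite size_nseq rev_nseq.
apply: reach_step; [by [] | lia |].
apply: reach_trans reach2 _ _; first lia.
have -> : (Bar :: bits o1) ++ bits (rev_nat n) = Bar :: bits o2 by rewrite /o2 map_cat.
apply: (@reach_step _ _ _ _ (at_left SFinal ((Bar :: bits o2) ++ [::]) r2)).
- by rewrite cats0.
- lia.
apply: reach_trans.
- apply: (@sweep_left _ _ nonblank); first by case.
  by rewrite /= nonblank_bits.
- by rewrite -[size (_ :: _)]/(size (bits o2)).+1 size_map; lia.
rewrite -[size (_ :: bits _)]/(size (bits o2)).+1 size_map.
apply: reach_step; [by [] | lia |].
rewrite [_ :: _ ++ _]/= rev_cons cat_rcons -map_rev /o2 /o1 -catA; exact: reach_refl.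
Qed.

(** * Assembling the output and bounding the total time *)

Lemma rev_enc_nats ys : rev (enc_nats ys) = flatten (map rev_nat (rev ys)).
Proof.
rewrite rev_flatten -map_comp map_rev; congr (flatten (rev _)).
by apply: eq_map => y; rewrite /= rev_cat rev_nseq.
Qed.

Lemma rev_rev_nat z : rev (rev_nat z) = enc_nat z.
Proof. by rewrite rev_cons rev_nseq -cats1. Qed.

Lemma rev_rev_blocks h ys : rev (flatten (map (rev_block h) (rev ys)))
  = flatten [seq rev h ++ [:: true; false] ++ enc_nat y | y <- ys].
Proof.
rewrite rev_flatten -map_comp map_rev revK; congr flatten.
by apply: eq_map => y; rewrite /= rev_cat rev_rev_nat rev_cat -catA.
Qed.

Lemma size_rev_blocks h ys : size (flatten (map (rev_block h) ys))
  = size (flatten (map rev_nat ys)) + size ys * (size h + 2).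
Proof. by elim: ys => //= y ys IH; rewrite !size_cat IH /= size_nseq; nia. Qed.

Lemma size_le_rev_nats ys : size ys <= size (flatten (map rev_nat ys)).
Proof. by elim: ys => //= y ys IH; rewrite ltnS size_cat; lia. Qed.

(** The hypothesis on [p'] says that the common prefix ends in a zero, which separates it from 1^m.
    The output has quadratic length and each of its bits costs a trip of quadratic length, hence the
    fourth power. *)
Lemma split_machine_reach ys p p' :
  let n := (size ys).+1 in
  let hd := nseq n true ++ false :: p in
  let w := hd ++ enc_nats (size ys :: ys) in
  false :: p = rcons p' false ->
  exists l r, reach split_delta (110 * size w ^ 4)
    (at_right SCount [::] (bits w))
    (at_right SHalt l (bits (enc_nat n ++ enc_nat (size ys)
       ++ flatten [seq hd ++ [:: true; false] ++ enc_nat y | y <- ys]) ++ Bar :: r)).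
Proof.
move=> n hd w ep.
set m := size ys; set h := rev hd.
have eh : h = false :: rev p' ++ nseq n true.
  by rewrite /h /hd ep rev_cat rev_rcons rev_nseq.
have eh1 : h = rev p ++ false :: nseq n true.
  by rewrite /h /hd rev_cat rev_cons rev_nseq cat_rcons.
set o := flatten (map (rev_block h) (rev ys)).
have sh : size h = n + size p + 1 by rewrite size_rev size_cat size_nseq /=; lia.
have sw : size w = size h + m + 1 + size (enc_nats ys).
  rewrite size_cat -[size hd]size_rev -/h -/m /enc_nats /= size_cat /enc_nat size_cat.
  by rewrite size_nseq /= /m; lia.
have sy : size (flatten (map rev_nat (rev ys))) = size (enc_nats ys).
  by rewrite -rev_enc_nats size_rev.
have so : size o = size (enc_nats ys) + m * (size h + 2).
  by rewrite /o size_rev_blocks sy size_rev.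
have lem : m <= size (enc_nats ys).
  by rewrite -sy -[m]size_rev; apply: size_le_rev_nats.
have en : n = m.+1 by [].
(* A bound on the whole tape, output included; it is quadratic as the prefix is copied m times. *)
pose D := size w * size w + 5 * size w + 20.
have leD : 2 * size (enc_nats ys) + m + size h + size o + m + n + 12 <= D.
  by rewrite so /D; nia.
have r1 : reach split_delta (n.+2 * (2 * D)) (at_right SCount [::] (bits w))
    (at_left SNext (split_tape m h (rev ys) [::]) (nseq 1 Blank)).
  have := @split_prepare D ys p; rewrite -/m -/n -/hd rev_enc_nats -/h /w /hd -catA.
  by apply; lia.
have [k r2] : exists k', reach split_delta (size o * (2 * D + 3))
    (at_left SNext (split_tape m h (rev ys) [::]) (nseq 1 Blank))
    (at_left SNext (split_tape m h [::] ([::] ++ o)) (nseq k' Blank)).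
  move: leD; rewrite /o eh => leD; apply: blocks_reach.
  by rewrite size_split_tape sy cat0s; lia.
have [|r r3] := @finish_reach D m n h (rev p) _ ([::] ++ o) (nseq k Blank) eh eh1.
  by rewrite size_split_tape cat0s /=; lia.
exists [:: Blank], r.
have -> : enc_nat n ++ enc_nat m ++ flatten [seq hd ++ [:: true; false] ++ enc_nat y | y <- ys]
    = rev (([::] ++ o) ++ rev_nat m ++ rev_nat n).
  by rewrite cat0s !rev_cat /o rev_rev_blocks !rev_rev_nat /h revK -catA.
apply: (@reach_le _ _ (n.+2 * (2 * D) + (size o * (2 * D + 3) + (m + n + 5) * (2 * D + 3)))).
  (* From length 3 on, [D] is at most 5 times the squared length; then [2 * D + 3] and [2 * D] are
     at most 11 and 10 times it, which gives 110. *)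
  have w3 : 3 <= size w by lia.
  have leD5 : D <= 5 * (size w * size w) by rewrite /D; nia.
  apply: (@leq_trans ((2 * D + 3) * (2 * D))); last first.
    have -> : 110 * size w ^ 4 = (11 * (size w * size w)) * (10 * (size w * size w)).
      by rewrite !expnS expn0; lia.
    by apply: leq_mul; nia.
  have : n.+2 + size o + (m + n + 5) <= 2 * D by rewrite /D; nia.
  by move=> le2; nia.
apply: reach_trans r1 _ _; first by rewrite leq_addr.
rewrite addKn; apply: reach_trans r2 _ _; first by rewrite leq_addr.
by rewrite addKn; apply: r3.
Qed.

(** A constant factor is traded for degree: [L ^ 6] is at least 64 and 640 exceeds 600, so 10 serves
    as both coefficient and exponent. *)
Lemma quartic_le_poly L T : 1 < L -> T <= 600 * L ^ 4 -> T <= 10 * L ^ 10 + 10.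
Proof.
move=> L1 leT; have : 2 ^ 6 <= L ^ 6 by rewrite leq_exp2r.
have -> : L ^ 10 = L ^ 4 * L ^ 6 by rewrite -expnD.
move: (L ^ 4) (L ^ 6) leT => x y; rewrite -[2 ^ 6]/64 => leT ley.
by apply: leq_trans leT _; nia.
Qed.

(** * Correctness of the reduction *)

(** Every unary number ends in a zero: the last one belongs to the last gate, or is the gate count
    if there are no gates. *)
Lemma enc_gates_rcons gs : exists s, false :: enc_nat (size gs) ++ flatten (map enc_gate gs)
  = rcons s false.
Proof.
case/lastP: gs => [|gs g] /=; first by exists [:: false].
rewrite map_rcons flatten_rcons.
have [s ->] : exists s, enc_gate g = rcons s false.
  by case: g => [i j|i j|i]; eexists; rewrite /= /enc_nat ?catA cats1 -?rcons_cons.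
by eexists; rewrite -!rcons_cat -rcons_cons.
Qed.

Definition output_circuit C o := Circuit (cin C) (gates C) [:: o].
Definition ulc_of C := ULC (cin C) (map (output_circuit C) (outs C)).

Lemma ulc_of_instance C : pwpp_instance C -> ulc_instance (ulc_of C).
Proof.
move=> [/andP[wfg wfo] _ so]; split; first by rewrite /= size_map.
move=> i; rewrite /= size_map => lti; rewrite (nth_map 0) //; split=> //.
by rewrite /circuit_wf /= wfg (all_nthP 0 wfo).
Qed.

Lemma ulc_pred_ulc_of C i x : i < size (outs C) ->
  ulc_pred (ulc_of C) i x = nth false (eval_circuit C x) i.
Proof. by move=> lti; rewrite /ulc_pred /= (nth_map 0) // /eval_circuit [RHS](nth_map 0). Qed.

Lemma ulc_of_solution C a : pwpp_instance C -> ulc_solution (ulc_of C) a ->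
  pwpp_solution C (nth [::] a (cin C).-1, nth [::] a (cin C)).
Proof.
move=> [_ n0 so] [/= sa /all_nthP sz ua eqp].
split=> /=; try by apply/eqP/sz; lia.
  by apply/eqP; rewrite nth_uniq ?sa //; lia.
apply: (@eq_from_nth _ false); first by rewrite !size_map.
move=> i; rewrite size_map => lti.
by rewrite -!ulc_pred_ulc_of //; apply: eqp; rewrite -?so //; lia.
Qed.

Lemma enc_pwppE C : enc_pwpp C =
  (nseq (cin C) true ++ false :: enc_nat (size (gates C)) ++ flatten (map enc_gate (gates C)))
  ++ enc_nats (size (outs C) :: outs C).
Proof. by rewrite /enc_pwpp /enc_circuit /enc_nats /enc_nat -!catA /= -!catA. Qed.

Lemma split_machine_computes C : pwpp_instance C ->
  computes_in_poly split_machine 10 (enc_pwpp C) (enc_ulc (ulc_of C)).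
Proof.
move=> [_ n0 so]; have en : cin C = (size (outs C)).+1 by lia.
have [s es] := enc_gates_rcons (gates C).
have := @split_machine_reach (outs C) _ s es; rewrite -en -enc_pwppE => -[l [r rc]].
rewrite (_ : enc_ulc _ = enc_nat (cin C) ++ enc_nat (size (outs C)) ++
   flatten [seq (nseq (cin C) true ++ false :: enc_nat (size (gates C))
     ++ flatten (map enc_gate (gates C))) ++ [:: true; false] ++ enc_nat y | y <- outs C]).
  apply: (computes_compile split_statesP rc) => //.
  apply: quartic_le_poly; first by rewrite enc_pwppE 2!size_cat size_nseq /=; lia.
  by rewrite leq_mul2r orbT.
rewrite /enc_ulc /= size_map; congr (_ ++ _ ++ flatten _).
rewrite -map_comp; apply: eq_map => y.
by rewrite /= /enc_circuit /= /enc_nat -!catA /= -?catA.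
Qed.

Lemma pair_machine_computes C a : pwpp_instance C -> ulc_solution (ulc_of C) a ->
  computes_in_poly pair_machine 10 (enc_pwpp C ++ enc_ulc_sol a)
    (enc_pwpp_sol (nth [::] a (cin C).-1, nth [::] a (cin C))).
Proof.
move=> instC solC; have [/= s1 s2 _ _] := ulc_of_solution instC solC.
have [_ n0 _] := instC; have [/= sa _ _ _] := solC.
set x := nth _ _ _ in s1 *; set y := nth _ _ (cin C) in s2 *.
have ea : a = take (cin C).-1 a ++ [:: x; y].
  rewrite -[LHS](cat_take_drop (cin C).-1); congr (_ ++ _).
  rewrite (drop_nth [::]) ?sa; last lia.
  rewrite prednK // (drop_nth [::]) ?sa; last lia.
  by rewrite drop_oversize ?sa.
have : size (enc_pwpp_sol (x, y)) = (4 * cin C).+2.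
  by rewrite /enc_pwpp_sol /enc_bits /enc_nat /= !size_cat !size_nseq /= s1 s2; lia.
have : enc_ulc_sol a = (enc_nat (size a) ++ flatten (map enc_bits (take (cin C).-1 a)))
    ++ enc_pwpp_sol (x, y).
  by rewrite /enc_ulc_sol {2}ea map_cat flatten_cat /= cats0 -catA.
(* The dot travels 4n cells; [c] and [d] are the two further bits of the encoded collision that the
   final steps cross. *)
case: (enc_pwpp_sol _) => [|c [|d z]] // -> [sz].
pose p := (enc_nat (size (gates C)) ++ flatten (map enc_gate (gates C))
   ++ enc_nats (size (outs C) :: outs C))
   ++ enc_nat (size a) ++ flatten (map enc_bits (take (cin C).-1 a)).
pose w := nseq (cin C) true ++ false :: p ++ [:: c; d] ++ z.
have -> : enc_pwpp C ++ (enc_nat (size a)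
    ++ flatten (map enc_bits (take (cin C).-1 a))) ++ [:: c, d & z] = w.
  by rewrite /w /p enc_pwppE -!catA cat_cons -!catA.
have [l rc] := @pair_machine_reach (cin C) p c d z n0 sz.
apply: (computes_compile pair_statesP rc) => //.
rewrite -/w; have w1 : 1 < size w by rewrite /w size_cat size_nseq /=; lia.
by apply: quartic_le_poly => //; rewrite !expnS expn0; nia.
Qed.

Theorem theorem3 : pwpp_reduces_to_ulc.
Proof.
exists split_machine, pair_machine, 10 => C instC; exists (ulc_of C).
split; [exact: ulc_of_instance | exact: split_machine_computes | move=> a solC].
exists (nth [::] a (cin C).-1, nth [::] a (cin C)); split.
  exact: ulc_of_solution.
exact: pair_machine_computes.
Qed.
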